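(* Let $M$ be a compact oriented two-dimensional smooth manifold, and consider the split metric $G^{\mathfrak a,\mathfrak b,\mathfrak c,\mathfrak d}$ on the space $\Omega^1_+(M,\mathbb R^3)$ of full-ranked $\mathbb R^3$-valued one-forms. If $\mathfrak d=0$, then the pullback of the split metric under the differential $f\mapsto df$ gives rise to the elastic metric on the space of immersions $\mathrm{Imm}(M,\mathbb R^3)$; that is, there are constants $a,b,c\ge 0$ (determined by $\mathfrak a,\mathfrak b,\mathfrak c$) such that for every $f\in \mathrm{Imm}(M,\mathbb R^3)$ and every $u\in T_f\mathrm{Imm}(M,\mathbb R^3)=C^\infty(M,\mathbb R^3)$, $$G^{\mathfrak a,\mathfrak b,\mathfrak c,0}_{df}(du,du)= a\int_M \mathrm{tr}\big(g^{-1}\,\delta g\, g^{-1}\,\delta g\big)\,\mu_g + b\int_M \big(\mathrm{tr}(g^{-1}\delta g)\big)^2\mu_g + c\int_M \langle \delta n,\delta n\rangle_{\mathbb R^3}\,\mu_g ,$$ where $g=g^f$ and $n=n^f$ are the induced metric and unit normal field of $f$, $\mu_g$ is the induced volume density, and $\delta g,\delta n$ are the first variations of $g^f,n^f$ in direction $u$.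
   Context: $\mathrm{Imm}(M,\mathbb R^3)$ is the space of smooth immersions $f:M\to\mathbb R^3$. For an immersion $f$: $g^f=f^*\langle\cdot,\cdot\rangle_{\mathbb R^3}$ is the induced Riemannian metric, $\mu_g$ its volume density, and $n^f$ is the unit normal field, given in positively oriented local coordinates $(x,y)$ by $n^f=\frac{f_x\times f_y}{|f_x\times f_y|}$. For $u\in C^\infty(M,\mathbb R^3)$, $\delta g=\frac{d}{d\varepsilon}\big|_{\varepsilon=0}g^{f+\varepsilon u}$ and $\delta n=\frac{d}{d\varepsilon}\big|_{\varepsilon=0}n^{f+\varepsilon u}$. In the integrals, $g^{-1}\delta g$ is the $(1,1)$-tensor field obtained by raising an index of $\delta g$ with $g$. The elastic metric is, by definition, the expression on the right-hand side of the displayed formula, where $a,b,c\ge 0$ are constants. $\Omega^1(M,\mathbb R^3)$ is the space of smooth $\mathbb R^3$-valued one-forms on $M$, and $\Omega^1_+(M,\mathbb R^3)$ is the subset of those $\alpha$ that are full-ranked, i.e. $\alpha_x:T_xM\to\mathbb R^3$ is injective for all $x\in M$. Fix an auxiliary Riemannian metric on $M$ with volume form $\mu$; using local orthonormal frames for it, one-forms are written pointwise as $3\times 2$ matrices. For $\alpha\in\Omega^1_+(M,\mathbb R^3)$ and $\xi\in T_\alpha\Omega^1_+(M,\mathbb R^3)=\Omega^1(M,\mathbb R^3)$ set $$G_\alpha(\xi,\xi)=\int_M \mathrm{tr}\big(\xi_x(\alpha_x^T\alpha_x)^{-1}\xi_x^T\big)\sqrt{\det(\alpha_x^T\alpha_x)}\;\mu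 ,$$ which does not depend on the choice of the frames or of the auxiliary metric. Let $\alpha^+=(\alpha^T\alpha)^{-1}\alpha^T$ and decompose $\xi=\xi_m+\frac12\mathrm{tr}(\alpha^+\xi)\alpha+\xi^\perp+\xi_0$ with $$\xi_m=\tfrac12\alpha(\alpha^T\alpha)^{-1}(\alpha^T\xi+\xi^T\alpha)-\tfrac12\mathrm{tr}(\alpha^+\xi)\alpha,\quad \xi^\perp=\xi-\alpha(\alpha^T\alpha)^{-1}\alpha^T\xi,\quad \xi_0=\tfrac12\alpha(\alpha^T\alpha)^{-1}(\alpha^T\xi-\xi^T\alpha).$$ The split metric with coefficients $\mathfrak a,\mathfrak b,\mathfrak c,\mathfrak d$ is $$G^{\mathfrak a,\mathfrak b,\mathfrak c,\mathfrak d}_\alpha(\xi,\xi)=\mathfrak a\,G_\alpha(\xi_m,\xi_m)+\mathfrak b\,G_\alpha\big(\tfrac12\mathrm{tr}(\alpha^+\xi)\alpha,\tfrac12\mathrm{tr}(\alpha^+\xi)\alpha\big)+\mathfrak c\,G_\alpha(\xi^\perp,\xi^\perp)+\mathfrak d\,G_\alpha(\xi_0,\xi_0).$$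
   Formalization: The claim a,b,c≥0 fails for general split coefficients, since the identity forces a=𝔞/4, b=(𝔟−𝔞)/8, c=𝔠; the identity is proved for all real 𝔞,𝔟,𝔠, with a≥0 asserted if 𝔞≥0, b≥0 if 𝔞≤𝔟, and c≥0 if 𝔠≥0. *)

(* Defs.v *)
From HB Require Import structures.
From mathcomp Require Import all_boot all_order all_algebra.
From mathcomp Require Import finmap.
From mathcomp Require Import all_classical all_reals all_analysis.

Set Implicit Arguments.
Unset Strict Implicit.
Unset Printing Implicit Defensive.

Import Order.TTheory GRing.Theory Num.Theory.
Import numFieldNormedType.Exports.
Local Open Scope classical_set_scope.
Local Open Scope ring_scope.

Section Calculus.
Variable R : realType.

Definition iter_derive (W : normedModType R) (s : seq (R * R)) (F : R * R -> W)
  : R * R -> W :=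
  foldr (fun v G => 'D_v G) F s.

(* C^oo on D (meant for D open): all iterated directional derivatives, hence
   all iterated partial derivatives, exist and are Frechet differentiable at
   every point of D. *)
Definition smooth_on (W : normedModType R) (D : set (R * R)) (F : R * R -> W) :=
  forall (s : seq (R * R)) (x : R * R), D x -> differentiable (iter_derive s F) x.

Lemma near_differentiable (V W : normedModType R) (f g : V -> W) x :
  (\forall y \near x, f y = g y) -> differentiable f x -> differentiable g x.
Proof.
move=> fg df; have [cf fE] := (diff_locallyP _ _).1 df.
have gE : g \o shift x = cst (g x) + 'd f x +o_ 0 id.
  apply/eqaddoP => e e0; have /eqaddoP/(_ e e0) := fE.
  have fg0 : \forall h \near (0 : V), f (h + x) = g (h + x).
    by move: fg; rewrite (near_shift 0) subr0.
  have fgx : f x = g x := nbhs_singleton fg.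
  apply: filterS2 fg0 => h /=; rewrite !fctE /shift /= => ->.
  by rewrite fgx.
have dg := diff_unique cf gE.
by apply/diff_locallyP; rewrite dg.
Qed.

Section Open.
Variables (D : set (R * R)) (oD : open D).

Lemma iter_derive_eq (W : normedModType R) (F G : R * R -> W) s x :
  (forall y, D y -> F y = G y) -> D x -> iter_derive s F x = iter_derive s G x.
Proof.
move=> FG; elim: s x => [|v s IH] x Dx /=; first exact: FG.
apply: near_eq_derive; near=> y; apply: IH; near: y.
exact: open_nbhs_nbhs.
Unshelve. all: by end_near. Qed.

Lemma smooth_on_eq (W : normedModType R) (F G : R * R -> W) :
  (forall y, D y -> F y = G y) -> smooth_on D F -> smooth_on D G.
Proof.
move=> FG sF s x Dx; apply: near_differentiable (sF s x Dx).
near=> y; apply: iter_derive_eq => //; near: y; exact: open_nbhs_nbhs.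
Unshelve. all: by end_near. Qed.

Lemma smooth_on_derive (W : normedModType R) (F : R * R -> W) v :
  smooth_on D F -> smooth_on D ('D_v F).
Proof.
by move=> sF s x Dx; have := sF (rcons s v) x Dx; rewrite /iter_derive foldr_rcons.
Qed.

Lemma iter_derive_coord m n (F : R * R -> 'M[R]_(m.+1, n.+1)) k l s x :
  smooth_on D F -> D x ->
  iter_derive s (fun y => F y k l) x = iter_derive s F x k l.
Proof.
move=> sF; elim: s x => [//|v s IH] x Dx /=.
rewrite derive_mx ?mxE; last exact/diff_derivable/sF.
apply: near_eq_derive; near=> y; apply: IH; near: y.
exact: open_nbhs_nbhs.
Unshelve. all: by end_near. Qed.

Lemma smooth_on_coord m n (F : R * R -> 'M[R]_(m.+1, n.+1)) k l :
  smooth_on D F -> smooth_on D (fun y => F y k l).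
Proof.
move=> sF s x Dx.
apply: (@near_differentiable _ _ (fun y => iter_derive s F y k l)).
  near=> y; apply/esym/iter_derive_coord => //; near: y; exact: open_nbhs_nbhs.
apply: (@differentiable_comp _ _ _ _ (iter_derive s F)
  (fun N : 'M[R]_(m.+1, n.+1) => N k l : R)); first exact: sF.
exact: differentiable_coord.
Unshelve. all: by end_near. Qed.

Lemma differentiable_mx m n (F : R * R -> 'M[R]_(m.+1, n.+1)) x :
  (forall k l, differentiable (fun y => F y k l) x) -> differentiable F x.
Proof.
move=> dF.
rewrite (_ : F = \sum_k \sum_l (fun y => F y k l *: delta_mx k l)); last first.
  apply/funext => y; rewrite fct_sumE {1}(matrix_sum_delta (F y)).
  by apply: eq_bigr => k _; rewrite fct_sumE.
apply: differentiable_sum => k; apply: differentiable_sum => l.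
exact: differentiableZl.
Qed.

Lemma smooth_on_mx m n (F : R * R -> 'M[R]_(m.+1, n.+1)) :
  (forall k l, smooth_on D (fun y => F y k l)) -> smooth_on D F.
Proof.
move=> sF.
suff H s : (forall x, D x -> differentiable (iter_derive s F) x) /\
    (forall x k l, D x ->
      iter_derive s F x k l = iter_derive s (fun y => F y k l) x).
  by move=> s x Dx; exact: (H s).1.
elim: s => [|v s [IH1 IH2]].
  by split=> // x Dx; apply: differentiable_mx => k l; exact: (sF k l [::]).
have H2 x k l : D x ->
    iter_derive (v :: s) F x k l = iter_derive (v :: s) (fun y => F y k l) x.
  move=> Dx /=; rewrite derive_mx ?mxE; last exact/diff_derivable/IH1.
  apply: near_eq_derive; near=> y; apply: IH2; near: y.
  exact: open_nbhs_nbhs.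
split=> // x Dx; apply: differentiable_mx => k l.
apply: near_differentiable (sF k l (v :: s) x Dx).
near=> y; rewrite H2//; near: y; exact: open_nbhs_nbhs.
Unshelve. all: by end_near. Qed.

End Open.
Lemma derive_chain (W : normedModType R) (F : R * R -> W) (tau : R * R -> R * R)
    x v : differentiable tau x -> differentiable F (tau x) ->
  'D_v (F \o tau) x = ('D_v tau x).1 *: 'D_(1, 0) F (tau x)
                    + ('D_v tau x).2 *: 'D_(0, 1) F (tau x).
Proof.
move=> dt dF; rewrite deriveE; last exact: differentiable_comp.
rewrite diff_comp//= -!deriveE// deriveE//.
rewrite [in LHS](_ : 'D_v tau x =
  ('D_v tau x).1 *: ((1, 0) : R * R) + ('D_v tau x).2 *: ((0, 1) : R * R)).
  by rewrite linearD !linearZ !deriveE.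
case: ('D_v tau x) => a b /=; congr (_, _); rewrite /= -![_ *: _]/(_ * _).
  by rewrite mulr1 mulr0 addr0.
by rewrite mulr1 mulr0 add0r.
Qed.

Definition basis2 (l : 'I_2) : R * R := if l == 0 then (1, 0) else (0, 1).

Definition jacobian2 (tau : R * R -> R * R) (x : R * R) : 'M[R]_2 :=
  \matrix_(k, l) (if k == 0 then ('D_(basis2 l) tau x).1
                  else ('D_(basis2 l) tau x).2).

(* The library's norm on matrices is the sup norm, so the Euclidean structure
   of R^3 is introduced explicitly. *)
Definition dot (v w : 'cV[R]_3) : R := (v^T *m w) 0 0.

Definition euclid_norm (v : 'cV[R]_3) : R := Num.sqrt (dot v v).

Definition cross (v w : 'cV[R]_3) : 'cV[R]_3 :=
  \col_k (v (k + 1) 0 * w (k + 2) 0 - v (k + 2) 0 * w (k + 1) 0).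

End Calculus.

(* A compact oriented smooth surface without boundary, presented by an atlas of
   charts [coord i : dom i -> R * R], with inverses [param i], whose transition
   maps are smooth and orientation preserving.  [coord i] and [param i] are
   total functions, only meaningful on [dom i] and its image.  Second
   countability follows from compactness.  [chart_at p] selects a chart around
   p, in whose coordinates pointwise invariant quantities are computed. *)
Record surface (R : realType) := Surface {
  carrier :> topologicalType;
  surface_hausdorff : hausdorff_space carrier;
  surface_compact : compact [set: carrier];
  chart : Type;
  dom : chart -> set carrier;
  coord : chart -> carrier -> R * R;
  param : chart -> R * R -> carrier;
  chart_at : carrier -> chart;
  dom_chart_at : forall p, dom (chart_at p) p;
  dom_open : forall i, open (dom i);
  coord_open : forall i, open (coord i @` dom i);
  coordK : forall i p, dom i p -> param i (coord i p) = p;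
  coord_continuous : forall i p, dom i p -> {for p, continuous (coord i)};
  param_continuous : forall i x,
    (coord i @` dom i) x -> {for x, continuous (param i)};
  transition_smooth : forall i j,
    smooth_on (coord i @` (dom i `&` dom j)) (coord j \o param i);
  transition_oriented : forall i j p, dom i p -> dom j p ->
    0 < \det (jacobian2 (coord j \o param i) (coord i p)) }.

Arguments dom {R s} i.
Arguments coord {R s} i.
Arguments param {R s} i.
Arguments chart_at {R s} p.

Section Surface.
Variables (R : realType) (M : surface R).
Implicit Types (i j : chart M) (p : M).

Definition chart_image i : set (R * R) := coord i @` dom i.

(* Derivative at p of the change of coordinates from chart i to chart j. *)
Definition transition i j p : 'M[R]_2 :=
  jacobian2 (coord j \o param i) (coord i p).

(* Local coordinates of p in chart i are (x, y) = coord i p; the l-th column is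
   the l-th partial derivative of f in these coordinates, i.e. the matrix of
   df_p in the coordinate basis. *)
Definition differential (f : M -> 'cV[R]_3) i p : 'M[R]_(3, 2) :=
  \matrix_(k, l) ('D_(basis2 R l) (f \o param i) (coord i p)) k 0.

Record smooth_map := SmoothMap {
  smooth_map_fun :> M -> 'cV[R]_3;
  smooth_mapP : forall i, smooth_on (chart_image i) (smooth_map_fun \o param i) }.

(* R^3-valued one-forms, given by their components in every chart: [a i p] is
   the matrix of the one-form at p in the coordinate basis of chart i, and is
   only meaningful for p in [dom i]. *)
Record one_form := OneForm {
  one_form_comp :> chart M -> M -> 'M[R]_(3, 2);
  one_form_transition : forall i j p, dom i p -> dom j p ->
    one_form_comp i p = one_form_comp j p *m transition i j p;
  one_form_smooth : forall i,
    smooth_on (chart_image i) (one_form_comp i \o param i) }.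

Definition full_rank (a : chart M -> M -> 'M[R]_(3, 2)) :=
  forall i p, dom i p -> injective (fun v : 'cV[R]_2 => a i p *m v).

Record full_rank_one_form := FullRankOneForm {
  full_rank_one_form_form :> one_form;
  full_rank_one_formP : full_rank full_rank_one_form_form }.

Record immersion := Immersion {
  immersion_map :> smooth_map;
  immersionP : full_rank (differential immersion_map) }.

Let differential_transition (f : smooth_map) i j p : dom i p -> dom j p ->
  differential f i p = differential f j p *m transition i j p.
Proof.
move=> ip jp.
have ijp : chart_image i (coord i p) by exists p.
have near_ij : \forall x \near coord i p,
    (f \o param j) ((coord j \o param i) x) = (f \o param i) x.
  have pj : \forall x \near coord i p, dom j (param i x).
    apply: (param_continuous ijp); rewrite coordK//.
    by apply: open_nbhs_nbhs; split=> //; exact: dom_open.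
  by apply: filterS pj => x jx /=; rewrite coordK.
have dt : differentiable (coord j \o param i) (coord i p).
  by apply: (@transition_smooth _ M i j [::]); exists p.
have tp : (coord j \o param i) (coord i p) = coord j p by rewrite /= coordK.
have df : differentiable (f \o param j) ((coord j \o param i) (coord i p)).
  by rewrite tp; apply: (@smooth_mapP f j [::]); exists p.
apply/matrixP => k l; rewrite !mxE (bigD1 0)//= (bigD1 1)//= big1 ?addr0; last first.
  by move=> -[[|[|//]] lt2]// /andP[].
rewrite -(near_eq_derive _ near_ij) derive_chain// tp !mxE /=.
by rewrite /basis2/= mulrC; congr (_ + _); rewrite mulrC.
Qed.

Let differential_smooth (f : smooth_map) i :
  smooth_on (chart_image i) (differential f i \o param i).
Proof.
have oi : open (chart_image i) := @coord_open _ M i.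
apply: (@smooth_on_eq _ _ oi _
  (fun x => \matrix_(k, l) ('D_(basis2 R l) (f \o param i) x) k 0)).
  by move=> _ [p ip <-]; rewrite /= /differential coordK.
apply: smooth_on_mx => // k l.
apply: (@smooth_on_eq _ _ oi _ (fun x => ('D_(basis2 R l) (f \o param i) x) k 0)).
  by move=> x _; rewrite mxE.
apply: smooth_on_coord => //; apply: smooth_on_derive; exact: smooth_mapP.
Qed.

Definition d_map (f : smooth_map) : one_form :=
  OneForm (differential_transition f) (differential_smooth f).

Definition d_immersion (f : immersion) : full_rank_one_form :=
  @FullRankOneForm (d_map f) (@immersionP f).

Record riemannian_metric := RiemannianMetric {
  metric_comp :> chart M -> M -> 'M[R]_2;
  metric_transition : forall i j p, dom i p -> dom j p ->
    metric_comp i p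
    = (transition i j p)^T *m metric_comp j p *m transition i j p;
  metric_sym : forall i p, dom i p -> (metric_comp i p)^T = metric_comp i p;
  metric_gt0 : forall i p (v : 'cV[R]_2), dom i p -> v != 0 ->
    0 < (v^T *m metric_comp i p *m v) 0 0;
  metric_smooth : forall i, smooth_on (chart_image i) (metric_comp i \o param i) }.

(* Continuous partitions of unity suffice for integration. *)
Record partition_of_unity := PartitionOfUnity {
  pou_index : finType;
  pou_chart : pou_index -> chart M;
  pou_weight : pou_index -> M -> R;
  pou_continuous : forall k, continuous (pou_weight k);
  pou_ge0 : forall k p, 0 <= pou_weight k p;
  pou_support : forall k,
    closure [set p | pou_weight k p != 0] `<=` dom (pou_chart k);
  pou_sum : forall p, \sum_k pou_weight k p = 1 }.

Let bump p : exists f : M -> R, [/\ continuous f, forall q, 0 <= f q, 0 < f p &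
  closure [set q | f q != 0] `<=` dom (chart_at p)].
Proof.
have nM := compact_normal (@surface_hausdorff _ M) (@surface_compact _ M).
have cp : closed [set p].
  exact/accessible_closed_set1/hausdorff_accessible/surface_hausdorff.
have cD : closed (~` dom (chart_at p)) by apply/open_closedC/dom_open.
have D0 : ~` dom (chart_at p) `&` [set p] = set0.
  rewrite -subset0 => q [nq qp]; apply: nq; rewrite qp; exact: dom_chart_at.
have /(@normal_separatorP R) := nM => /(_ _ _ cD cp D0).
move=> /(@uniform_separatorP _ R)[g [gc _ g0 g1]].
have gp : g p = 1 by apply: g1; exists p.
have fc : continuous (fun q => Num.max (g q - 2^-1) 0).
  move=> q; apply: (@continuous_max _ _ (fun q => g q - 2^-1) (cst 0)).
    by apply: (@continuousB _ _ _ g (cst 2^-1)); [exact: gc|exact: cst_continuous].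
  exact: cst_continuous.
exists (fun q => Num.max (g q - 2^-1) 0); split => //.
- by move=> q; rewrite le_max lexx orbT.
- by rewrite gp lt_max subr_gt0 invf_lt1// ltr1n.
- have clg : closed [set q | 2^-1 <= g q].
    apply: (@preimage_closed _ _ g [set y | 2^-1 <= y]); last exact: closed_ge.
    by move=> q _; exact: gc.
  apply: (@subset_trans _ [set q | 2^-1 <= g q]).
    rewrite [X in _ `<=` X](closure_id _).1//; apply: closureS => q /=.
    apply: contraR; rewrite -ltNge => /ltW gq.
    by apply/eqP/max_idPr; rewrite subr_le0.
  move=> q /= gq; apply: contrapT => nq.
  have : g q = 0 by apply: g0; exists q.
  by move=> gq0; move: gq; rewrite gq0 leNgt invr_gt0 ltr0n.
Qed.

Lemma partition_of_unity_exists : exists _ : partition_of_unity, True.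
Proof.
pose f p := projT1 (cid (bump p)).
have fP p : [/\ continuous (f p), forall q, 0 <= f p q, 0 < f p p &
  closure [set q | f p q != 0] `<=` dom (chart_at p)].
  exact: projT2 (cid (bump p)).
have [[p0 _]|M0] := pselect (exists p : M, True); last first.
  have M0' (p : M) : False by apply: M0; exists p.
  suff P : partition_of_unity by exists P.
  by apply: (@PartitionOfUnity void (fun k => match k with end)
    (fun k => match k with end)) => // p; case: (M0' p).
pose pM : ptopologicalType := HB.pack (carrier M) (isPointed.Build (carrier M) p0).
have : cover_compact [set: pM].
  by rewrite -compact_cover; exact: (@surface_compact _ M).
move=> /(_ M setT (fun p => [set q | 0 < f p q])) cov.
have /cid2[D _ DM] : exists2 D : {fset M}, {subset D <= [set: M]} &
    [set: M] `<=` cover [set` D] (fun p => [set q | 0 < f p q]).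
  apply: cov => [p _|p _]; last by exists p => //; case: (fP p).
  apply: (@open_comp _ _ (f p) [set y | 0 < y]); last exact: open_gt.
  by move=> q _; case: (fP p) => + _ _ _; exact.
pose S q := \sum_(k : D) f (fsval k) q.
have S0 q : 0 < S q.
  have [p pD /= fpq] := DM q I.
  rewrite /S (bigD1 (FSetSub pD))//= ltr_pwDl// sumr_ge0// => k _.
  by case: (fP (fsval k)).
have Sc : continuous S.
  move=> q; apply: (@cvg_big _ _ +%R 0); first exact: add_continuous.
  move=> k _.
  by case: (fP (fsval k)) => + _ _ _; exact.
suff P : partition_of_unity by exists P.
apply: (@PartitionOfUnity D (fun k => chart_at (fsval k))
  (fun k q => f (fsval k) q / S q)).
- move=> k q; apply: cvgM; first by case: (fP (fsval k)) => + _ _ _; exact.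
  by apply: (@cvgV _ _ (nbhs q) _ S); [rewrite gt_eqF|exact: Sc].
- by move=> k q; rewrite divr_ge0 ?(ltW (S0 q))//; case: (fP (fsval k)).
- move=> k; case: (fP (fsval k)) => _ _ _; apply: subset_trans.
  by apply: closureS => q /=; apply: contra_neq => ->; rewrite mul0r.
- by move=> q; rewrite -mulr_suml -[X in X / _]/(S q) divff// gt_eqF.
Qed.

(* Integral over M of F against the volume density of the metric h, which is
   sqrt(det h) dx dy in local coordinates; it does not depend on the selected
   partition of unity. *)
Definition surface_integral (h : chart M -> M -> 'M[R]_2) (F : M -> R) : R :=
  let P := projT1 (cid partition_of_unity_exists) in
  \sum_(k : pou_index P)
    \int[(@lebesgue_measure R \x @lebesgue_measure R)%E]_(x in
        chart_image (pou_chart k))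
      (let p := param (pou_chart k) x in
       pou_weight k p * F p * Num.sqrt (\det (h (pou_chart k) p))).

(* The columns of [E p] are the coordinates, in the chart [chart_at p], of an
   h-orthonormal basis of the tangent space at p.  No regularity in p is
   required, since only pointwise invariant expressions are formed. *)
Record orthonormal_frame (h : riemannian_metric) := OrthonormalFrame {
  frame :> M -> 'M[R]_2;
  frame_orthonormal : forall p,
    (frame p)^T *m h (chart_at p) p *m frame p = 1%:M }.

Definition in_frame h (E : orthonormal_frame h) (a : one_form) p : 'M[R]_(3, 2) :=
  a (chart_at p) p *m E p.

Definition metric_G (h : riemannian_metric) (A X : M -> 'M[R]_(3, 2)) : R :=
  surface_integral h (fun p =>
    \tr (X p *m invmx ((A p)^T *m A p) *m (X p)^T)
    * Num.sqrt (\det ((A p)^T *m A p))).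

(* X = part_m + part_tr + part_perp + part_0, pointwise; the matrices are taken
   with respect to an orthonormal frame. *)
Section Decomposition.
Variables A X : 'M[R]_(3, 2).

Definition pseudo_inverse : 'M[R]_(2, 3) := invmx (A^T *m A) *m A^T.

Definition part_tr : 'M[R]_(3, 2) := (2^-1 * \tr (pseudo_inverse *m X)) *: A.

Definition part_m : 'M[R]_(3, 2) :=
  2^-1 *: (A *m invmx (A^T *m A) *m (A^T *m X + X^T *m A)) - part_tr.

Definition part_perp : 'M[R]_(3, 2) := X - A *m invmx (A^T *m A) *m A^T *m X.

Definition part_0 : 'M[R]_(3, 2) :=
  2^-1 *: (A *m invmx (A^T *m A) *m (A^T *m X - X^T *m A)).

End Decomposition.

Definition split_metric h (E : orthonormal_frame h) (ca cb cc cd : R)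
    (alpha : full_rank_one_form) (xi : one_form) : R :=
  let A := in_frame E alpha in
  let X := in_frame E xi in
  ca * metric_G h A (fun p => part_m (A p) (X p))
  + cb * metric_G h A (fun p => part_tr (A p) (X p))
  + cc * metric_G h A (fun p => part_perp (A p) (X p))
  + cd * metric_G h A (fun p => part_0 (A p) (X p)).

Definition induced_metric (f : M -> 'cV[R]_3) i p : 'M[R]_2 :=
  (differential f i p)^T *m differential f i p.

(* All charts are positively oriented. *)
Definition unit_normal (f : M -> 'cV[R]_3) p : 'cV[R]_3 :=
  let df := differential f (chart_at p) p in
  let v := cross (col 0 df) (col 1 df) in
  (euclid_norm v)^-1 *: v.

Definition metric_variation (f u : M -> 'cV[R]_3) i p : 'M[R]_2 :=
  derive1 (fun e : R => induced_metric (fun q => f q + e *: u q) i p) 0.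

Definition normal_variation (f u : M -> 'cV[R]_3) p : 'cV[R]_3 :=
  derive1 (fun e : R => unit_normal (fun q => f q + e *: u q) p) 0.

Definition raised_variation (f u : M -> 'cV[R]_3) p : 'M[R]_2 :=
  invmx (induced_metric f (chart_at p) p) *m metric_variation f u (chart_at p) p.

Definition elastic_metric (a b c : R) (f : immersion) (u : smooth_map) : R :=
  let g := induced_metric f in
  a * surface_integral g (fun p =>
        \tr (raised_variation f u p *m raised_variation f u p))
  + b * surface_integral g (fun p => (\tr (raised_variation f u p)) ^+ 2)
  + c * surface_integral g (fun p =>
        dot (normal_variation f u p) (normal_variation f u p)).

End Surface.

(* Main.v *)
Require Import Defs.
From mathcomp Require Import all_boot all_order all_algebra.
From mathcomp Require Import ring.
From mathcomp Require Import all_classical all_reals all_analysis.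
Import Order.TTheory GRing.Theory Num.Theory.
Import numFieldNormedType.Exports.

Set Implicit Arguments.
Unset Strict Implicit.
Unset Printing Implicit Defensive.

Local Open Scope classical_set_scope.
Local Open Scope ring_scope.

(* Write A = df, X = du in a chart, g = A^T A and S = g^-1 (delta g), where
   delta g = A^T X + X^T A.  The squared norms of the m-part and of the trace
   part of X are (tr S^2)/4 - (tr S)^2/8 and (tr S)^2/8, while that of the
   normal part equals |delta n|^2, because delta n is tangent and
   A^T (delta n) = - X^T n.  These quantities are invariant under a change
   (A, X) -> (A E, X E) of frame, hence a = ca/4, b = (cb - ca)/8 and c = cc.
   Splitting the integral of the m-part requires integrability: in a chart of
   the partition of unity, the integrand is continuous on an open subset of the
   plane and vanishes off a compact subset of it. *)

(** * Gram matrices and unit normals *)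

Section LinearAlgebra.
Variable R : realType.

(** The integrand of [metric_G] apart from its density: the squared norm of X as a linear map into
    Euclidean space, the plane carrying the inner product with Gram matrix A^T A. *)
Definition sq_norm (A X : 'M[R]_(3, 2)) : R :=
  \tr (X *m invmx (A^T *m A) *m X^T).

Definition raised (A X : 'M[R]_(3, 2)) : 'M[R]_2 :=
  invmx (A^T *m A) *m (A^T *m X + X^T *m A).

Lemma ord2P (k : 'I_2) : k = 0 \/ k = 1.
Proof. by case: k => -[|[|//]] ?; [left|right]; apply: val_inj. Qed.

Lemma det_mx22 (A : 'M[R]_2) : \det A = A 0 0 * A 1 1 - A 0 1 * A 1 0.
Proof.
rewrite (expand_det_row A 0) big_ord_recl big_ord1 /cofactor !det_mx11 !mxE /=.
have -> : lift (0 : 'I_2) (0 : 'I_1) = 1 by apply: val_inj.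
have -> : lift (1 : 'I_2) (0 : 'I_1) = 0 by apply: val_inj.
by rewrite expr0 expr1 mul1r mulN1r mulrN.
Qed.

Lemma dotE (v w : 'cV[R]_3) :
  dot v w = v 0 0 * w 0 0 + v 1 0 * w 1 0 + v 2 0 * w 2 0.
Proof.
rewrite /dot mxE !big_ord_recl big_ord0 addr0 addrA !mxE.
by congr (_ * _ + _ * _ + _ * _); congr (_ _ 0); apply: val_inj.
Qed.

Lemma crossE (v w : 'cV[R]_3) :
  [/\ cross v w 0 0 = v 1 0 * w 2 0 - v 2 0 * w 1 0,
      cross v w 1 0 = v 2 0 * w 0 0 - v 0 0 * w 2 0 &
      cross v w 2 0 = v 0 0 * w 1 0 - v 1 0 * w 0 0].
Proof.
by split; rewrite mxE; congr (_ * _ - _ * _); congr (_ _ 0); apply: val_inj.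
Qed.

Lemma dotC (v w : 'cV[R]_3) : dot v w = dot w v.
Proof. by rewrite !dotE; ring. Qed.

Lemma trmulmxE m n (A : 'M[R]_(3, m)) (B : 'M[R]_(3, n)) k l :
  (A^T *m B) k l = dot (col k A) (col l B).
Proof. by rewrite /dot !mxE; apply: eq_bigr => i _; rewrite !mxE. Qed.

Lemma dot_ge0 (v : 'cV[R]_3) : 0 <= dot v v.
Proof. by rewrite dotE !addr_ge0// -expr2 sqr_ge0. Qed.

Lemma dot_eq0 (v : 'cV[R]_3) : dot v v = 0 -> v = 0.
Proof.
rewrite /dot mxE => /psumr_eq0P v0; apply/matrixP => k l; rewrite ord1 mxE.
have /eqP : v^T 0 k * v k 0 = 0.
  by apply: v0 => // i _; rewrite mxE -expr2 sqr_ge0.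
by rewrite mxE mulf_eq0 orbb => /eqP.
Qed.

Lemma dot_cross (v w : 'cV[R]_3) :
  dot (cross v w) (cross v w) = dot v v * dot w w - dot v w ^+ 2.
Proof. by rewrite !dotE; have [-> -> ->] := crossE v w; ring. Qed.

Lemma dot_crossl (v w : 'cV[R]_3) : dot v (cross v w) = 0.
Proof. by rewrite !dotE; have [-> -> ->] := crossE v w; ring. Qed.

Lemma dot_crossr (v w : 'cV[R]_3) : dot w (cross v w) = 0.
Proof. by rewrite !dotE; have [-> -> ->] := crossE v w; ring. Qed.

Definition normal_vector (A : 'M[R]_(3, 2)) : 'cV[R]_3 :=
  cross (col 0 A) (col 1 A).

(** Lagrange's identity. It makes invertibility of the Gram matrix equivalent to non-vanishing of
    the normal vector. *)
Lemma det_gram (A : 'M[R]_(3, 2)) :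
  \det (A^T *m A) = dot (normal_vector A) (normal_vector A).
Proof.
by rewrite det_mx22 !trmulmxE dot_cross (dotC (col 1 A)) expr2.
Qed.

Lemma tr_normal_vector (A : 'M[R]_(3, 2)) : A^T *m normal_vector A = 0.
Proof.
apply/matrixP => k l; rewrite trmulmxE [RHS]mxE (_ : col l _ = normal_vector A).
  by have [->|->] := ord2P k; [exact: dot_crossl|exact: dot_crossr].
by apply/matrixP => i j; rewrite [LHS]mxE !ord1.
Qed.

(** A row w with w A^T A = 0 satisfies |A w^T|^2 = 0, so injectivity of A forces w = 0. *)
Lemma gram_unit (A : 'M[R]_(3, 2)) :
  injective (fun v : 'cV[R]_2 => A *m v) -> A^T *m A \in unitmx.
Proof.
move=> injA; rewrite unitmxE unitfE; apply/negP => /det0P[w w0 wA].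
suff Aw : A *m w^T = 0.
  have /injA/(congr1 trmx) : A *m w^T = A *m 0 by rewrite mulmx0.
  by rewrite trmxK trmx0 => /eqP; rewrite (negbTE w0).
apply: dot_eq0; rewrite /dot trmx_mul trmxK -mulmxA (mulmxA A^T) mulmxA.
by rewrite wA mul0mx mxE.
Qed.

Lemma gram_sym (A : 'M[R]_(3, 2)) : (A^T *m A)^T = A^T *m A.
Proof. by rewrite trmx_mul trmxK. Qed.

Section Pointwise.
Variables A X : 'M[R]_(3, 2).
Hypothesis unitA : A^T *m A \in unitmx.
Let G := A^T *m A.
Let S := raised A X.
Let v := normal_vector A.

Let trinvG : (invmx G)^T = invmx G.
Proof. by rewrite trmx_inv gram_sym. Qed.

(** The two summands of tr S are transposes of each other up to cyclic permutation, because G^-1 is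
    symmetric. *)
Lemma tr_raised : \tr (pseudo_inverse A *m X) = 2^-1 * \tr S.
Proof.
rewrite /S /raised mulmxDr mxtraceD -/G.
have -> : \tr (invmx G *m (X^T *m A)) = \tr (invmx G *m (A^T *m X)).
  rewrite -mxtrace_tr !trmx_mul trinvG trmxK mxtrace_mulC.
  by rewrite mulmxA.
by rewrite /pseudo_inverse -/G -mulmxA; field.
Qed.

(** The trace is cyclically tr (Y G^-1 Y^T G), and self-adjointness of Y with respect to G turns Y^T
    G into G Y. It applies to the m-part and the trace part, both of the form A Y with such a Y. *)
Lemma sq_norm_mul (Y : 'M[R]_2) :
  G *m Y = Y^T *m G -> sq_norm A (A *m Y) = \tr (Y *m Y).
Proof.
move=> GY; rewrite /sq_norm trmx_mul -!mulmxA mxtrace_mulC -!mulmxA -/G -GY.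
by rewrite (mulmxA (invmx _)) mulVmx// mul1mx.
Qed.

Lemma raised_sym : G *m S = S^T *m G.
Proof.
rewrite /S /raised mulmxA mulmxV// mul1mx trmx_mul linearD /= !trmx_mul !trmxK.
by rewrite trinvG -mulmxA mulVmx// mulmx1 addrC.
Qed.

Lemma sq_norm_tr : sq_norm A (part_tr A X) = 8^-1 * \tr S ^+ 2.
Proof.
(* Here Y is the scalar matrix tr S / 4, whence tr Y^2 = 2 (tr S)^2 / 16. *)
rewrite /part_tr tr_raised -mul_mx_scalar sq_norm_mul.
  by rewrite -scalar_mxM mxtrace_scalar; field.
by rewrite tr_scalar_mx scalar_mxC.
Qed.

(** Y is now half the trace-free part of S, which is self-adjoint for G by [raised_sym]. *)
Lemma part_mE : part_m A X = A *m (2^-1 *: (S - (2^-1 * \tr S)%:M)).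
Proof.
rewrite /part_m /part_tr tr_raised /S /raised -!mulmxA -scalemxAr.
rewrite mulmxBr scalerBr.
by rewrite mul_mx_scalar scalerA.
Qed.

Lemma sq_norm_m :
  sq_norm A (part_m A X) = 4^-1 * \tr (S *m S) - 8^-1 * \tr S ^+ 2.
Proof.
rewrite part_mE sq_norm_mul.
  rewrite -scalemxAl -scalemxAr mulmxBl !mulmxBr -!scalar_mxM !mul_scalar_mx.
  rewrite mul_mx_scalar !(mxtraceZ, linearB) /= !mxtraceZ mxtrace_scalar.
  by field.
rewrite [(2^-1 *: _)^T]linearZ /= [(_ - _)^T]linearB /= tr_scalar_mx.
by rewrite -scalemxAr -scalemxAl mulmxBr mulmxBl raised_sym scalar_mxC.
Qed.

Hypothesis v0 : dot v v != 0.

(* The square matrix B = [A | v] is invertible, since B^T B is block diagonal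
   with blocks G and |v|^2. *)
Lemma projector : A *m invmx G *m A^T + (dot v v)^-1 *: (v *m v^T) = 1%:M.
Proof.
pose B : 'M[R]_3 := row_mx A v : 'M[R]_(3, 2 + 1).
pose C : 'M[R]_3 := block_mx (invmx G) 0 0 (dot v v)^-1%:M : 'M[R]_(2 + 1).
have vv : v^T *m v = (dot v v)%:M by rewrite [LHS]mx11_scalar.
have vA : v^T *m A = 0.
  by rewrite -[A in LHS]trmxK -trmx_mul tr_normal_vector trmx0.
have BBC : B^T *m B *m C = 1%:M.
  rewrite /B /C (@tr_row_mx R 3 2 1 A v) (@mul_col_row R 2 1 3 2 1 A^T v^T A v).
  rewrite vv vA tr_normal_vector (@mulmx_block R 2 1 2 1 2 1).
  rewrite !mulmx0 !mul0mx addr0 !add0r mulmxV// -scalar_mxM mulfV//.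
  by rewrite (@scalar_mx_block R 2 1 1).
(* B^T (B C) = 1 gives (B C) B^T = 1 since the matrices are square; its block expansion is the
   claim. *)
have := mulmx1C (etrans (mulmxA _ _ _) BBC); rewrite /B /C.
rewrite (@mul_row_block R 3 2 1 2 1) !mulmx0 addr0 add0r.
rewrite (@tr_row_mx R 3 2 1 A v).
rewrite (@mul_row_col R 3 2 1 3) mul_mx_scalar -scalemxAl; exact.
Qed.

(** By [projector] the normal part is the rank-one matrix |v|^-2 v (X^T v)^T, so its norm reduces to
    a quadratic form in X^T v. *)
Lemma sq_norm_perp :
  sq_norm A (part_perp A X)
  = (dot v v)^-1 * ((X^T *m v)^T *m invmx G *m (X^T *m v)) 0 0.
Proof.
have -> : part_perp A X = (dot v v)^-1 *: (v *m (X^T *m v)^T).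
  rewrite /part_perp -/G -[X in X - _]mul1mx -mulmxBl -projector addrC addKr.
  by rewrite -scalemxAl -mulmxA trmx_mul trmxK.
set w := X^T *m v.
rewrite /sq_norm [(_ *: _)^T]linearZ /= -!scalemxAl -scalemxAr !mxtraceZ.
rewrite (trmx_mul v) trmxK (mulmxA _ w) mxtrace_mulC -!mulmxA (mulmxA v^T).
rewrite [v^T *m v]mx11_scalar -/(dot v v) mul_scalar_mx mxtraceZ mulKf//.
by rewrite /mxtrace big_ord1.
Qed.

(** A vector orthogonal to v is fixed by the tangential projector A G^-1 A^T, so its length is
    determined by A^T n. *)
Lemma dot_tangent (n : 'cV[R]_3) : dot v n = 0 ->
  dot n n = ((A^T *m n)^T *m invmx G *m (A^T *m n)) 0 0.
Proof.
move=> vn.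
have nE : n = A *m (invmx G *m (A^T *m n)).
  rewrite -[LHS]mul1mx -projector mulmxDl -scalemxAl -[v *m _ *m n]mulmxA.
  have -> : v^T *m n = 0.
    by apply/matrixP => i j; rewrite !ord1 [RHS]mxE.
  by rewrite mulmx0 scaler0 addr0 !mulmxA.
by rewrite /dot {2}nE !mulmxA trmx_mul trmxK.
Qed.

End Pointwise.

(** * Change of frame in the tangent plane *)

Section Frame.
Variables (A X : 'M[R]_(3, 2)) (E : 'M[R]_2).
Hypotheses (unitA : A^T *m A \in unitmx) (unitE : E \in unitmx).

Lemma gram_mulmx : (A *m E)^T *m (A *m E) = E^T *m (A^T *m A) *m E.
Proof. by rewrite trmx_mul !mulmxA. Qed.

Lemma invmx_gram :
  invmx ((A *m E)^T *m (A *m E)) = invmx E *m invmx (A^T *m A) *m invmx E^T.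
Proof.
set B := RHS.
have EB : B *m ((A *m E)^T *m (A *m E)) = 1%:M.
  rewrite gram_mulmx /B -!mulmxA (mulmxA (invmx E^T)) mulVmx ?unitmx_tr//.
  rewrite mul1mx (mulmxA A^T) (mulmxA (invmx (A^T *m A))) mulVmx// mul1mx mulVmx//.
by have [_ uE] := mulmx1_unit EB; rewrite -[LHS]mul1mx -EB mulmxK.
Qed.

Lemma sq_norm_mulmx : sq_norm (A *m E) (X *m E) = sq_norm A X.
Proof.
rewrite /sq_norm invmx_gram trmx_mul -!mulmxA mulKVmx//.
by rewrite mulKmx ?unitmx_tr.
Qed.

(** S is an endomorphism of the tangent plane, so a change of frame conjugates it; the invariance of
    tr S and tr S^2 follows. *)
Lemma raised_mulmx : raised (A *m E) (X *m E) = invmx E *m raised A X *m E.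
Proof.
rewrite /raised invmx_gram !trmx_mul !mulmxDr mulmxDl -!mulmxA.
by rewrite !(mulmxA (invmx E^T)) !mulVmx ?unitmx_tr// !mul1mx.
Qed.

Lemma part_perp_mulmx : part_perp (A *m E) (X *m E) = part_perp A X *m E.
Proof.
rewrite /part_perp invmx_gram trmx_mul mulmxBl -!mulmxA mulKVmx//.
by rewrite mulKmx ?unitmx_tr.
Qed.

Lemma tr_raised_mulmx : \tr (raised (A *m E) (X *m E)) = \tr (raised A X).
Proof. by rewrite raised_mulmx mxtrace_mulC mulKVmx. Qed.

Lemma tr_raised2_mulmx :
  \tr (raised (A *m E) (X *m E) *m raised (A *m E) (X *m E))
  = \tr (raised A X *m raised A X).
Proof.
rewrite raised_mulmx -!mulmxA mulKVmx// mxtrace_mulC.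
by rewrite -!mulmxA mulmxV// mulmx1.
Qed.

End Frame.
End LinearAlgebra.

(** * Integrability on the plane *)

Section Plane.
Variable R : realType.

(** Measurability refers to the product sigma-algebra, so D is covered by countably many products of
    balls with rational centres and radius. *)
Lemma open_measurable_plane (D : set (R * R)) : open D ->
  measurable (D : set (measurableTypeR R * measurableTypeR R)).
Proof.
move=> oD.
pose B (q : rat * rat * rat) : set (measurableTypeR R * measurableTypeR R) :=
  (ball (ratr q.1.1 : R) (ratr q.2) `*` ball (ratr q.1.2 : R) (ratr q.2)).
(* Squares not contained in D are replaced by the empty set, so the union runs over all rational
   triples. *)
pose Q q : set (measurableTypeR R * measurableTypeR R) :=
  if `[< B q `<=` D >] then B q else set0.
have -> : D = \bigcup_q Q q.
  rewrite eqEsubset; split=> [[x y] Dxy|x [q _]]; last first.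
    by rewrite /Q; case: asboolP => // + Bx; exact.
  have /nbhs_ballP[e /= e0 eD] : nbhs (x, y) D by exact: open_nbhs_nbhs.
  (* With 2 r < e, a square of radius r through (x, y) stays within distance e of that point. *)
  have [r r0 re] : exists2 r : rat, 0 < ratr r :> R & ratr r < e / 2.
    have [r] := rat_in_itvoo (divr_gt0 e0 (ltr0Sn R 1)).
    by rewrite in_itv /= => /andP[]; exists r.
  have ratb (t : R) : exists a : rat, ball (ratr a : R) (ratr r) t.
    have [|a] := @rat_in_itvoo _ (t - ratr r) (t + ratr r).
      by rewrite ltrD2l gtrN.
    rewrite in_itv /= => /andP[ta tb]; exists a; rewrite ball_itv /= in_itv /=.
    by rewrite ltrBlDr tb -ltrBlDr ta.
  have [a ax] := ratb x; have [b bY] := ratb y.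
  exists (a, b, r) => //; rewrite /Q; case: asboolP; first by [].
  have tri (c t t' : R) :
      ball c (ratr r) t -> ball c (ratr r) t' -> ball t e t'.
    move=> ct ct'; apply: (@le_ball _ _ _ (ratr r + ratr r)).
      by rewrite [leRHS]splitr lerD// ltW.
    by apply: (ball_triangle _ ct'); exact: ball_sym.
  by case=> -[x' y'] [/= ax' bY']; apply: eD; split;
    [exact: tri ax ax'|exact: tri bY bY'].
apply: countable_bigcupT_measurable; first exact: countableP.
move=> q; rewrite /Q; case: ifP => // _.
by apply: measurableX; exact: measurable_realfun.measurable_ball.
Qed.

Lemma open_continuous_measurable_plane (D : set (R * R)) (psi : R * R -> R) :
  open D -> (forall x, D x -> {for x, continuous psi}) ->
  measurable_fun (D : set (measurableTypeR R * measurableTypeR R)) psi.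
Proof.
move=> oD cpsi mD.
apply: (measurability _ (measurable_realfun.RGenOpens.measurableE R)) => //.
move=> _ [_ [a [b ->]]] <-; apply: open_measurable_plane.
rewrite openE => x [Dx psix]; apply: filterI; first exact: open_nbhs_nbhs.
by apply: cpsi => //; apply: open_nbhs_nbhs; split=> //; exact: interval_open.
Qed.

(** D may have infinite measure, but psi vanishes on D outside a square B containing K. On D [&] B,
    of finite measure, psi is measurable, and it is bounded because K is compact. *)
Lemma integrable_continuous_compact_support (D K : set (R * R))
    (psi : R * R -> R) :
  open D -> compact K -> K `<=` D ->
  (forall x, D x -> {for x, continuous psi}) ->
  (forall x, D x -> ~ K x -> psi x = 0) ->
  (@lebesgue_measure R \x @lebesgue_measure R)%E.-integrable D (EFin \o psi).
Proof.
move=> oD cK KD cpsi psi0.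
have mpsi := open_continuous_measurable_plane oD cpsi.
have mD := open_measurable_plane oD.
have [C [_ CK]] : [bounded psi x | x in K].
  suff /compact_bounded[C [Cr CK]] : compact [set psi x | x in K].
    by exists C; split=> // c /CK h x Kx; apply: h; exists x.
  apply: continuous_compact => //; apply: continuous_in_subspaceT => x.
  by rewrite inE => /KD /cpsi.
have [N [_ NK]] := compact_bounded cK.
(* [compact_bounded] only bounds K by numbers strictly above N, and n must also be nonnegative. *)
pose n : R := `|N| + 1.
pose I : set (measurableTypeR R) := `[- n, n]%classic.
pose B := I `*` I.
have mB : measurable B by apply: measurableX; exact: measurable_itv.
have KB : K `<=` B.
  have NN : N < n by rewrite /n ltr_pwDr// ler_norm.
  move=> [x y] /(NK n NN) /=; rewrite prod_normE /= ge_max => /andP[xn yn].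
  by split; rewrite /I /= in_itv /= -ler_norml.
have mDB : measurable
    ((D : set (measurableTypeR R * measurableTypeR R)) `&` B).
  exact: measurableI.
have restr : (EFin \o psi) \_ D = (EFin \o psi) \_ (D `&` B).
  apply/funext => x; rewrite !patchE.
  case: ifPn => [|xD]; last by rewrite ifF//; apply/negbTE; apply: contra xD;
    rewrite !inE => -[].
  rewrite inE => Dx; case: ifPn => //; rewrite notin_setE => nDB /=.
  by rewrite psi0// => Kx; apply: nDB; split=> //; exact: KB.
apply/(integrable_mkcond _ mD); rewrite restr; apply/(integrable_mkcond _ mDB).
apply: measurable_bounded_integrable => //.
- apply: le_lt_trans (_ : (lebesgue_measure \x lebesgue_measure)%E B < +oo)%E.
    by apply: le_measure; rewrite ?inE//; exact: subIsetr.
  rewrite /B product_measure1E//; try exact: measurable_itv.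
  have Ifin : (@lebesgue_measure R I < +oo)%E.
    exact: compact_finite_measure (@segment_compact R (- n) n).
  by apply: lte_mul_pinfty => //; rewrite ge0_fin_numE.
- by apply: measurable_funS mpsi => //; exact: subIsetl.
(* C bounds psi on K; the maximum with 0 covers the points off K, where psi is 0. *)
- exists (Num.max C 0); split; first exact: num_real.
  move=> c; rewrite gt_max => /andP[Cc c0] x [Dx _].
  have [Kx|nKx] := pselect (K x); first exact: CK.
  by rewrite /= psi0// normr0 ltW.
Qed.
End Plane.

(** * First variations *)

Section Variation.
Variable R : realType.

Lemma is_derive_mx m n (F : R -> 'M[R]_(m, n)) (x v : R) (dF : 'M[R]_(m, n)) :
  (forall k l, is_derive x v (fun t => F t k l) (dF k l)) -> is_derive x v F dF.
Proof.
move=> FdF.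
have dbl : derivable F x v.
  by apply/derivable_mxP => k l; have [] := FdF k l.
apply: DeriveDef => //; apply/matrixP => k l.
by rewrite derive_mx// mxE; have [] := FdF k l.
Qed.

Lemma mx_quadE m n (A B C : 'M[R]_(m, n)) e k l :
  (A + e *: B + e ^+ 2 *: C) k l = A k l + e * B k l + e ^+ 2 * C k l.
Proof. by rewrite !mxE. Qed.

Lemma mx_scale_subE m n (A B : 'M[R]_(m, n)) x y k l :
  (x *: (A - y *: B)) k l = x * (A k l - y * B k l).
Proof. by rewrite !mxE. Qed.

Lemma dot_scale_sub (v w z : 'cV[R]_3) x y :
  dot v (x *: (w - y *: z)) = x * (dot v w - y * dot v z).
Proof. by rewrite !dotE !mxE; ring. Qed.

Lemma gramD (A X : 'M[R]_(3, 2)) e : (A + e *: X)^T *m (A + e *: X)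
  = A^T *m A + e *: (A^T *m X + X^T *m A) + e ^+ 2 *: (X^T *m X).
Proof.
rewrite [(A + _)^T]linearD /= [(e *: X)^T]linearZ /= mulmxDl !mulmxDr.
by rewrite -!scalemxAr -!scalemxAl scalerA -expr2 scalerDr !addrA.
Qed.

Lemma is_derive_gram (A X : 'M[R]_(3, 2)) :
  is_derive (0 : R) 1 (fun e => (A + e *: X)^T *m (A + e *: X))
    (A^T *m X + X^T *m A).
Proof.
apply: is_derive_mx => k l.
set a := (A^T *m A) k l; set b := (A^T *m X + X^T *m A) k l.
set c := (X^T *m X) k l.
have -> : (fun e => ((A + e *: X)^T *m (A + e *: X)) k l)
    = fun e => a + e * b + e ^+ 2 * c.
  by apply/funext => e; rewrite gramD mx_quadE.
apply: is_derive_eq; rewrite /GRing.scale /=; ring.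
Qed.

Definition normal_deriv (A X : 'M[R]_(3, 2)) : 'cV[R]_3 :=
  cross (col 0 X) (col 1 A) + cross (col 0 A) (col 1 X).

Lemma normal_vectorD (A X : 'M[R]_(3, 2)) e : normal_vector (A + e *: X)
  = normal_vector A + e *: normal_deriv A X + e ^+ 2 *: normal_vector X.
Proof. by apply/matrixP => k l; rewrite !mxE; ring. Qed.

(** The derivative of v / |v|: the component of v' orthogonal to v, divided by |v|. *)
Definition unit_normal_deriv (A X : 'M[R]_(3, 2)) : 'cV[R]_3 :=
  let v := normal_vector A in
  (euclid_norm v)^-1 *:
    (normal_deriv A X - ((dot v v)^-1 * dot v (normal_deriv A X)) *: v).

Lemma is_derive_unit_normal (A X : 'M[R]_(3, 2)) :
  dot (normal_vector A) (normal_vector A) != 0 ->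
  is_derive (0 : R) 1
    (fun e =>
      (euclid_norm (normal_vector (A + e *: X)))^-1 *: normal_vector (A + e *: X))
    (unit_normal_deriv A X).
Proof.
move=> v0; apply: is_derive_mx => k l; rewrite ord1.
set v := normal_vector A; set v' := normal_deriv A X; set w := normal_vector X.
(* The coordinates c and the squared norm q are polynomials in e, so their derivatives are inferred;
   the square root and the inverse are treated separately. *)
pose c (i : 'I_3) (e : R) := v i 0 + e * v' i 0 + e ^+ 2 * w i 0.
pose q e := c 0 e ^+ 2 + c 1 e ^+ 2 + c 2 e ^+ 2.
have cE i e : normal_vector (A + e *: X) i 0 = c i e.
  by rewrite normal_vectorD mx_quadE.
have -> : (fun e =>
    ((euclid_norm (normal_vector (A + e *: X)))^-1
      *: normal_vector (A + e *: X)) k 0)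
    = fun e => (Num.sqrt (q e))^-1 * c k e.
  by apply/funext => e; rewrite mxE cE /euclid_norm dotE !cE -!expr2.
have dc i : is_derive (0 : R) 1 (c i) (v' i 0).
  apply: is_derive_eq; rewrite /GRing.scale /=; ring.
have dq : is_derive (0 : R) 1 q (2 * dot v v').
  apply: is_derive_eq; rewrite dotE /c /GRing.scale /=; ring.
have c0 i : c i 0 = v i 0 by rewrite /c; ring.
have q0 : q 0 = dot v v by rewrite /q !c0 dotE -!expr2.
have qgt0 : 0 < q 0 by rewrite q0 lt_neqAle eq_sym v0 dot_ge0.
have s0 : Num.sqrt (q 0) != 0 by rewrite sqrtr_eq0 -ltNge.
have ds : is_derive (0 : R) 1 (Num.sqrt \o q)
    ((2 * Num.sqrt (q 0))^-1 * (2 * dot v v')).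
  by apply: is_derive1_comp; exact: is_derive1_sqrt.
have dV := @is_deriveV R (Num.sqrt \o q) 0 _ 1 s0 ds.
apply: is_derive_eq.
rewrite !c0 /unit_normal_deriv -/v -/v' mx_scale_subE /euclid_norm /= q0.
rewrite -![_ *: _]/(_ * _).
(* Writing |v|^2 as s^2 with s = |v| leaves an identity of rational functions in s. *)
have : Num.sqrt (dot v v) ^+ 2 = dot v v by rewrite sqr_sqrtr// dot_ge0.
rewrite -q0; move: s0; set s := Num.sqrt _ => s0 sE.
by rewrite -sE; field.
Qed.

(** By [dot_tangent] and [sq_norm_perp] both sides are |v|^-2 times the same quadratic form in X^T
    v. *)
Lemma unit_normal_derivP (A X : 'M[R]_(3, 2)) :
  A^T *m A \in unitmx -> dot (normal_vector A) (normal_vector A) != 0 ->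
  dot (unit_normal_deriv A X) (unit_normal_deriv A X)
  = sq_norm A (part_perp A X).
Proof.
move=> unitA v0; set d := unit_normal_deriv A X.
pose v := normal_vector A; pose N := euclid_norm v.
have vd : dot v d = 0.
  rewrite /d /unit_normal_deriv -/v dot_scale_sub mulrAC mulVf// mul1r subrr.
  by rewrite mulr0.
have Ad : A^T *m d = - N^-1 *: (X^T *m v).
  (* With columns a, b of A and p, q of X, v = a x b and v' = p x b + a x q, so
     that a.v' = - p.v and b.v' = - q.v. *)
  have Av : A^T *m normal_deriv A X = - (X^T *m v).
    apply/matrixP => k l; rewrite ord1 trmulmxE [RHS]mxE trmulmxE.
    have colE (y : 'cV[R]_3) : col 0 y = y.
      by apply/matrixP => i j; rewrite [LHS]mxE !ord1.
    rewrite !colE /normal_deriv /v /normal_vector !dotE.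
    have [c0 c1 c2] := crossE (col 0 X) (col 1 A).
    have [d0 d1 d2] := crossE (col 0 A) (col 1 X).
    have [e0 e1 e2] := crossE (col 0 A) (col 1 A).
    rewrite ![(_ + _ : 'cV[R]_3) _ _]mxE c0 c1 c2 d0 d1 d2 e0 e1 e2.
    rewrite ![col _ _ _ _]mxE.
    by have [->|->] := ord2P k; ring.
  rewrite /d /unit_normal_deriv -scalemxAr mulmxBr -scalemxAr.
  by rewrite tr_normal_vector scaler0 subr0 Av scalerN scaleNr.
rewrite (dot_tangent unitA v0 vd) Ad sq_norm_perp//.
rewrite [(_ *: _)^T]linearZ /= -!scalemxAl -scalemxAr scalerA mxE.
congr (_ * _).
by rewrite mulrNN -expr2 exprVn sqr_sqrtr// dot_ge0.
Qed.
End Variation.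

(** * Continuity of the integrands *)

Section Raised.
Variable R : realType.

Lemma mxtrace22 (A : 'M[R]_2) : \tr A = A 0 0 + A 1 1.
Proof.
rewrite /mxtrace big_ord_recl big_ord1.
by have -> : lift (0 : 'I_2) (0 : 'I_1) = 1 by apply: val_inj.
Qed.

(** The determinant of 2 by 2 matrices is a quadratic form, and this is its polarization. It reduces
    continuity of tr (A^-1 B) to that of determinants. *)
Lemma tr_adj_mx22 (A B : 'M[R]_2) :
  \tr (\adj A *m B) = \det (A + B) - \det A - \det B.
Proof.
rewrite mxtrace22 !mxE !big_ord_recl !big_ord0.
have -> : lift (0 : 'I_2) (0 : 'I_1) = 1 by apply: val_inj.
have l1 : lift (1 : 'I_2) (0 : 'I_1) = 0 by apply: val_inj.
have l0 : lift (0 : 'I_2) (0 : 'I_1) = 1 by apply: val_inj.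
rewrite !mxE /cofactor !det_mx11 !mxE /= l0 l1 !det_mx22 !mxE /=; ring.
Qed.

Lemma tr_invmx22 (A B : 'M[R]_2) : A \in unitmx ->
  \tr (invmx A *m B) = (\det A)^-1 * (\det (A + B) - \det A - \det B).
Proof. by move=> uA; rewrite /invmx uA -scalemxAl mxtraceZ tr_adj_mx22. Qed.

(* The trace of the Cayley-Hamilton identity. *)
Lemma tr_sqr22 (A : 'M[R]_2) : \tr (A *m A) = \tr A ^+ 2 - 2 * \det A.
Proof.
rewrite !mxtrace22 !mxE det_mx22 !big_ord_recl !big_ord0.
have -> : lift (0 : 'I_2) (0 : 'I_1) = 1 by apply: val_inj.
ring.
Qed.

Section Continuity.
Variables (T : topologicalType) (x : T).

Definition mx_continuous_at m n (A : T -> 'M[R]_(m, n)) :=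
  forall k l, A y k l @[y --> x] --> A x k l.

Lemma mx_continuousM m n p (A : T -> 'M[R]_(m, n)) (B : T -> 'M[R]_(n, p)) :
  mx_continuous_at A -> mx_continuous_at B ->
  mx_continuous_at (fun y => A y *m B y).
Proof.
move=> cA cB k l; rewrite mxE; under eq_fun do rewrite mxE.
apply: (@cvg_big _ _ +%R 0); first exact: add_continuous.
by move=> j _; apply: cvgM; [exact: cA|exact: cB].
Qed.

Lemma mx_continuousT m n (A : T -> 'M[R]_(m, n)) :
  mx_continuous_at A -> mx_continuous_at (fun y => (A y)^T).
Proof.
by move=> cA k l; rewrite mxE; under eq_fun do rewrite mxE; exact: cA.
Qed.

Lemma mx_continuousD m n (A B : T -> 'M[R]_(m, n)) :
  mx_continuous_at A -> mx_continuous_at B ->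
  mx_continuous_at (fun y => A y + B y).
Proof.
move=> cA cB k l; rewrite mxE; under eq_fun do rewrite mxE.
by apply: cvgD; [exact: cA|exact: cB].
Qed.

Lemma det_continuous (A : T -> 'M[R]_2) :
  mx_continuous_at A -> \det (A y) @[y --> x] --> \det (A x).
Proof.
move=> cA; rewrite det_mx22; under eq_fun do rewrite det_mx22.
by apply: cvgB; apply: cvgM; exact: cA.
Qed.

Section RaisedContinuous.
Variables A X : T -> 'M[R]_(3, 2).
Hypotheses (cA : mx_continuous_at A) (cX : mx_continuous_at X).
Hypothesis unitA : \forall y \near x, (A y)^T *m A y \in unitmx.

Let cG : mx_continuous_at (fun y => (A y)^T *m A y).
Proof. by apply: mx_continuousM => //; exact: mx_continuousT. Qed.

Let cB : mx_continuous_at (fun y => (A y)^T *m X y + (X y)^T *m A y).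
Proof.
by apply: mx_continuousD; apply: mx_continuousM => //; exact: mx_continuousT.
Qed.

Let cV : (\det ((A y)^T *m A y))^-1 @[y --> x] --> (\det ((A x)^T *m A x))^-1.
Proof.
apply: cvgV; last exact: det_continuous.
by rewrite -unitfE -unitmxE; exact: nbhs_singleton unitA.
Qed.

Lemma tr_raised_continuous :
  \tr (raised (A y) (X y)) @[y --> x] --> \tr (raised (A x) (X x)).
Proof.
rewrite {2}/raised tr_invmx22; last exact: nbhs_singleton unitA.
(* The Gram matrix is known to be invertible only near x, so the determinant formula is substituted
   locally. *)
apply: (cvg_trans (near_eq_cvg _)).
  by near=> y; rewrite /raised tr_invmx22//; near: y; exact: unitA.
apply: cvgM; first exact: cV.
apply: cvgB; last exact: det_continuous.
apply: cvgB; last exact: det_continuous.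
by apply: det_continuous; exact: mx_continuousD.
Unshelve. all: by end_near. Qed.

Lemma tr_raised2_continuous :
  \tr (raised (A y) (X y) *m raised (A y) (X y)) @[y --> x] -->
    \tr (raised (A x) (X x) *m raised (A x) (X x)).
Proof.
 (* [det_inv] also covers singular matrices, where both of its sides are 0, so this rewriting is
    valid at every y. *)
 under eq_fun do rewrite tr_sqr22 {2}/raised det_mulmx det_inv.
rewrite tr_sqr22 {2}/raised det_mulmx det_inv.
apply: cvgB.
  by rewrite expr2; apply: cvgM; exact: tr_raised_continuous.
apply: cvgM; first exact: cvg_cst.
by apply: cvgM; [exact: cV|exact: det_continuous].
Qed.

End RaisedContinuous.
End Continuity.
End Raised.

(** * Integration over the surface *)

Section SurfaceIntegral.
Variables (R : realType) (M : surface R).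
Implicit Types (h : chart M -> M -> 'M[R]_2) (F : M -> R).

(** Integrand and density are compared as one product, which lets a density factor pass from the
    integrand to the metric. *)
Lemma eq_surface_integral h h' F F' :
  (forall i p, dom i p ->
    F p * Num.sqrt (\det (h i p)) = F' p * Num.sqrt (\det (h' i p))) ->
  surface_integral h F = surface_integral h' F'.
Proof.
move=> FF'; apply: eq_bigr => k _; apply: eq_Rintegral => x.
rewrite inE => -[p kp <-] /=; rewrite coordK// -!mulrA; congr (_ * _).
exact: FF'.
Qed.

Lemma surface_integral_linear h F1 F2 a b :
  (forall i x, chart_image i x ->
    [/\ {for x, continuous (fun y => \det (h i (param i y)))},
        {for x, continuous (F1 \o param i)} &
        {for x, continuous (F2 \o param i)}]) ->
  surface_integral h (fun p => a * F1 p + b * F2 p)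
  = a * surface_integral h F1 + b * surface_integral h F2.
Proof.
move=> cont; rewrite /surface_integral; set P := projT1 _.
rewrite !big_distrr -big_split /=; apply: eq_bigr => k _.
set D := chart_image _.
have oD : open D := @coord_open _ M _.
pose w := pou_weight k.
pose i := pou_chart k.
pose psi F x :=
  w (param i x) * F (param i x) * Num.sqrt (\det (h i (param i x))).
have psi_int F : (forall x, D x -> {for x, continuous (F \o param i)}) ->
    (@lebesgue_measure R \x @lebesgue_measure R)%E.-integrable D
      (EFin \o psi F).
  move=> cF.
  (* K is the chart image of the support of the weight. The support is closed in the compact M and
     lies in the chart domain, so K is compact. *)
  pose K := Defs.coord i @` closure [set p | w p != 0].
  have KD : K `<=` D.
    by move=> _ [p wp <-]; exists p => //; exact: pou_support wp.
  apply: (@integrable_continuous_compact_support _ D K) => //.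
  - apply: continuous_compact.
      apply: continuous_in_subspaceT => p; rewrite inE => /pou_support.
      exact: Defs.coord_continuous.
    apply: subclosed_compact (@surface_compact _ M) _ => //.
    exact: closed_closure.
  - move=> x Dx; have [ch _ _] := cont _ _ Dx.
    apply: cvgM; last first.
      exact: (@continuous_comp _ _ _ (fun y => \det (h i (param i y))) Num.sqrt
        x ch (@sqrt_continuous _ _)).
    apply: cvgM; last exact: cF.
    exact: (@continuous_comp _ _ _ (param i) w x (param_continuous Dx)
      (@pou_continuous _ _ _ k _)).
  - move=> x [p ip <-] nK; rewrite /psi coordK//.
    have -> : w p = 0.
      apply/eqP; apply: contrapT => /negP wp; apply: nK; exists p => //.
      exact: subset_closure.
    by rewrite !mul0r.
have i1 := psi_int F1 (fun x Dx => let: And3 _ c _ := cont _ _ Dx in c).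
have i2 := psi_int F2 (fun x Dx => let: And3 _ _ c := cont _ _ Dx in c).
have mD := open_measurable_plane oD.
rewrite -(RintegralZl a mD i1) -(RintegralZl b mD i2).
rewrite -RintegralD//; last 2 first.
- by have := integrableZl mD a i1.
- by have := integrableZl mD b i2.
by apply: eq_Rintegral => x _; rewrite /psi /w /i; ring.
Qed.

End SurfaceIntegral.

(** * Variations of an immersion in charts *)

Section Immersions.
Variables (R : realType) (M : surface R).

Lemma smooth_map_differentiable (f : smooth_map M) i x :
  chart_image i x -> differentiable (f \o param i) x.
Proof. exact: (@smooth_mapP _ _ f i [::]). Qed.

Lemma differentialD (f u : smooth_map M) i p e : dom i p ->
  differential (fun q => f q + e *: u q) i p
  = differential f i p + e *: differential u i p.
Proof.
move=> ip; apply/matrixP => k l; rewrite !mxE.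
have ix : chart_image i (Defs.coord i p) by exists p.
have df := @diff_derivable _ _ _ _ _ (basis2 R l)
  (smooth_map_differentiable f ix).
have du := @diff_derivable _ _ _ _ _ (basis2 R l)
  (smooth_map_differentiable u ix).
have -> : (fun q => f q + e *: u q) \o param i
  = (f \o param i) + e \*: (u \o param i) by [].
by rewrite (deriveD df (derivableZ (k := e) du)) (deriveZ e du) !mxE.
Qed.

Lemma metric_variationE (f u : smooth_map M) i p : dom i p ->
  metric_variation f u i p
  = (differential f i p)^T *m differential u i p
    + (differential u i p)^T *m differential f i p.
Proof.
move=> ip; rewrite /metric_variation derive1E.
under eq_fun do rewrite /induced_metric differentialD//.
by have [_] := is_derive_gram (differential f i p) (differential u i p).
Qed.

Lemma raised_variationE (f u : smooth_map M) p :
  raised_variation f u p = raised (differential f (chart_at p) p)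
                                  (differential u (chart_at p) p).
Proof.
by rewrite /raised_variation metric_variationE//; exact: dom_chart_at.
Qed.

Lemma immersion_unit (f : immersion M) i p : dom i p ->
  (differential f i p)^T *m differential f i p \in unitmx.
Proof. by move=> ip; apply: gram_unit; exact: (@immersionP _ _ f). Qed.

Lemma immersion_normal_vector (f : immersion M) i p : dom i p ->
  dot (normal_vector (differential f i p)) (normal_vector (differential f i p))
  != 0.
Proof. by rewrite -det_gram -unitfE -unitmxE; exact: immersion_unit. Qed.

Lemma normal_variationE (f : immersion M) (u : smooth_map M) p :
  normal_variation f u p = unit_normal_deriv (differential f (chart_at p) p)
                                             (differential u (chart_at p) p).
Proof.
have ip := @dom_chart_at _ M p.
rewrite /normal_variation derive1E.
under eq_fun do rewrite /unit_normal differentialD//.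
by have [_] := is_derive_unit_normal (differential u (chart_at p) p)
  (immersion_normal_vector f ip).
Qed.

Lemma differential_transition (f : smooth_map M) i j p : dom i p -> dom j p ->
  differential f i p = differential f j p *m transition i j p.
Proof. exact: (@one_form_transition _ _ (d_map f)). Qed.

Lemma transition_unit (i j : chart M) (p : M) : dom i p -> dom j p ->
  transition i j p \in unitmx.
Proof.
by move=> ip jp; rewrite unitmxE unitfE gt_eqF// transition_oriented.
Qed.

(** [chart_at p] depends on p without any regularity, so continuity has to be read off in a fixed
    chart i. The transition matrix acts as a change of frame. *)
Lemma tr_raised_chart (f : immersion M) (u : smooth_map M) i p : dom i p ->
  \tr (raised_variation f u p)
  = \tr (raised (differential f i p) (differential u i p)).
Proof.
move=> ip; have jp := @dom_chart_at _ M p; rewrite raised_variationE.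
rewrite (differential_transition f ip jp) (differential_transition u ip jp).
by rewrite tr_raised_mulmx//; [exact: immersion_unit|exact: transition_unit].
Qed.

Lemma tr_raised2_chart (f : immersion M) (u : smooth_map M) i p : dom i p ->
  \tr (raised_variation f u p *m raised_variation f u p)
  = \tr (raised (differential f i p) (differential u i p)
         *m raised (differential f i p) (differential u i p)).
Proof.
move=> ip; have jp := @dom_chart_at _ M p; rewrite raised_variationE.
rewrite (differential_transition f ip jp) (differential_transition u ip jp).
by rewrite tr_raised2_mulmx//; [exact: immersion_unit|exact: transition_unit].
Qed.

Lemma differential_continuous (f : smooth_map M) i x : chart_image i x ->
  mx_continuous_at x (fun y => differential f i (param i y)).
Proof.
move=> ix k l.
have df : differentiable (differential f i \o param i) x.
  exact: (@one_form_smooth _ _ (d_map f) i [::]).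
exact: (@continuous_comp _ _ _ (differential f i \o param i)
  (fun N : 'M[R]_(3, 2) => N k l) x (differentiable_continuous df)
  (@coord_continuous _ _ _ k l _)).
Qed.

Lemma near_chart_image (i : chart M) (P : M -> Prop) x : chart_image i x ->
  (forall p, dom i p -> P p) -> \forall y \near x, P (param i y).
Proof.
move=> ix iP; have : \forall y \near x, chart_image i y.
  by apply: open_nbhs_nbhs; split=> //; exact: Defs.coord_open.
by apply: filterS => _ [p ip <-]; rewrite coordK//; exact: iP.
Qed.

Section Integrands.
Variables (f : immersion M) (u : smooth_map M) (i : chart M) (x : R * R).
Hypothesis ix : chart_image i x.

Let near_unit : \forall y \near x,
  (differential f i (param i y))^T *m differential f i (param i y) \in unitmx.
Proof.
exact: (near_chart_image (P := fun p =>
  (differential f i p)^T *m differential f i p \in unitmx) ix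
  (@immersion_unit f i)).
Qed.

Let cf := @differential_continuous f i x ix.
Let cu := @differential_continuous u i x ix.

Lemma det_induced_continuous :
  {for x, continuous (fun y => \det (induced_metric f i (param i y)))}.
Proof.
by apply: det_continuous; apply: mx_continuousM => //; exact: mx_continuousT.
Qed.

Lemma tr_raised_sqr_continuous :
  {for x, continuous ((fun p => \tr (raised_variation f u p) ^+ 2) \o param i)}.
Proof.
pose G p := \tr (raised (differential f i p) (differential u i p)).
pose F p := G p * G p.
have FE p : dom i p -> F p = \tr (raised_variation f u p) ^+ 2.
  by move=> ip; rewrite (tr_raised_chart f u ip) expr2.
have cG : G (param i y) @[y --> x] --> G (param i x).
  exact: (tr_raised_continuous cf cu near_unit).
suff : F (param i y) @[y --> x] --> F (param i x).
  rewrite (FE (param i x)); last by case: ix => p ip <-; rewrite coordK.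
  by apply: cvg_trans; apply: near_eq_cvg; exact: near_chart_image FE.
exact: (cvgM cG cG).
Qed.

Lemma tr_raised2_continuous_chart :
  {for x, continuous ((fun p =>
     \tr (raised_variation f u p *m raised_variation f u p)) \o param i)}.
Proof.
pose F p := \tr (raised (differential f i p) (differential u i p)
  *m raised (differential f i p) (differential u i p)).
have FE p : dom i p ->
    F p = \tr (raised_variation f u p *m raised_variation f u p).
  by move=> ip; rewrite (tr_raised2_chart f u ip).
suff : F (param i y) @[y --> x] --> F (param i x).
  rewrite (FE (param i x)); last by case: ix => p ip <-; rewrite coordK.
  by apply: cvg_trans; apply: near_eq_cvg; exact: near_chart_image FE.
exact: (tr_raised2_continuous cf cu near_unit).
Qed.

End Integrands.

(** * The parts of the split metric as elastic integrals *)

Section Frame.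
Variables (h : riemannian_metric M) (E : orthonormal_frame h) (f : immersion M).

Lemma frame_unit p : E p \in unitmx.
Proof. by have [_] := mulmx1_unit (frame_orthonormal E p). Qed.

(** Orthonormality gives (det E)^2 det h = 1 in the chart [chart_at p], so the factor (det E)^2 of
    det (A^T A) cancels det h and leaves det g. Passing to chart i multiplies both sides by the same
    squared Jacobian. *)
Lemma surface_integral_frame F :
  let A := in_frame E (d_immersion f) in
  surface_integral h (fun p => F p * Num.sqrt (\det ((A p)^T *m A p)))
  = surface_integral (induced_metric f) F.
Proof.
apply: eq_surface_integral => i p ip; rewrite -mulrA; congr (_ * _).
rewrite -sqrtrM; last by rewrite det_gram dot_ge0.
have jp := @dom_chart_at _ M p; congr Num.sqrt.
rewrite (metric_transition h ip jp) /induced_metric.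
rewrite (differential_transition f ip jp) /in_frame /=.
rewrite !gram_mulmx !det_mulmx !det_tr.
have /(congr1 determinant) := frame_orthonormal E p.
rewrite !det_mulmx det_tr det1 => hE.
rewrite -[RHS]mulr1 -hE; ring.
Qed.

Variable u : smooth_map M.
Let A := in_frame E (d_immersion f).
Let X := in_frame E (d_map u).
Let S := raised_variation f u.

Let unitA p : (A p)^T *m A p \in unitmx.
Proof.
rewrite gram_mulmx !unitmx_mul unitmx_tr frame_unit andbT /=.
by apply: immersion_unit; exact: dom_chart_at.
Qed.

Let unit_p p := immersion_unit f (@dom_chart_at _ M p).

Let tr_raised_frame p : \tr (raised (A p) (X p)) = \tr (S p).
Proof.
rewrite /S raised_variationE; exact: tr_raised_mulmx (unit_p p) (frame_unit p).
Qed.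

Let tr_raised2_frame p :
  \tr (raised (A p) (X p) *m raised (A p) (X p)) = \tr (S p *m S p).
Proof.
rewrite /S raised_variationE; exact: tr_raised2_mulmx (unit_p p) (frame_unit p).
Qed.

Lemma metric_G_m : metric_G h A (fun p => part_m (A p) (X p))
  = 4^-1 * surface_integral (induced_metric f) (fun p => \tr (S p *m S p))
    + (- 8^-1) * surface_integral (induced_metric f) (fun p => \tr (S p) ^+ 2).
Proof.
rewrite -surface_integral_linear; last first.
  move=> i x ix; split; first exact: det_induced_continuous.
    exact: tr_raised2_continuous_chart.
  exact: tr_raised_sqr_continuous.
rewrite -surface_integral_frame; apply: eq_surface_integral => i p ip.
congr (_ * _ * _).
by rewrite -/(sq_norm _ _) sq_norm_m// tr_raised_frame tr_raised2_frame mulNr.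
Qed.

Lemma metric_G_tr : metric_G h A (fun p => part_tr (A p) (X p))
  = 8^-1 * surface_integral (induced_metric f) (fun p => \tr (S p) ^+ 2).
Proof.
(* A zero multiple of the same integral is added, so that taking in the factor 1/8 becomes an
   instance of [surface_integral_linear]. *)
rewrite -[RHS]addr0 -[X in _ + X](mul0r (surface_integral (induced_metric f)
  (fun p => \tr (S p) ^+ 2))) -surface_integral_linear; last first.
  by move=> i x ix; split;
    [exact: det_induced_continuous|exact: tr_raised_sqr_continuous..].
rewrite -surface_integral_frame; apply: eq_surface_integral => i p ip.
congr (_ * _ * _).
by rewrite -/(sq_norm _ _) sq_norm_tr// tr_raised_frame mul0r addr0.
Qed.

Lemma metric_G_perp : metric_G h A (fun p => part_perp (A p) (X p))
  = surface_integral (induced_metric f)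
      (fun p => dot (normal_variation f u p) (normal_variation f u p)).
Proof.
rewrite -surface_integral_frame; apply: eq_surface_integral => i p ip.
congr (_ * _ * _); rewrite -/(sq_norm _ _).
(* The normal variation is expressed in the coordinate basis of [chart_at p], so E is first removed
   from the normal part. *)
rewrite /A /X part_perp_mulmx ?sq_norm_mulmx ?frame_unit ?unit_p//.
rewrite normal_variationE unit_normal_derivP ?unit_p//.
by apply: immersion_normal_vector; exact: dom_chart_at.
Qed.

End Frame.
End Immersions.

Theorem theorem2 (R : realType) (ca cb cc : R) :
  exists a b c : R,
    [/\ 0 <= ca -> 0 <= a, ca <= cb -> 0 <= b, 0 <= cc -> 0 <= c
      & forall (M : surface R) (h : riemannian_metric M)
               (E : orthonormal_frame h) (f : immersion M) (u : smooth_map M),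
          split_metric E ca cb cc 0 (d_immersion f) (d_map u)
          = elastic_metric a b c f u].
Proof.
(* The coefficient of (tr S)^2 collects -ca/8 from the m-part and cb/8 from the trace part; its sign
   is therefore governed by ca <= cb. *)
exists (4^-1 * ca), (8^-1 * (cb - ca)), cc; split=> //.
- by move=> ca0; rewrite mulr_ge0.
- by move=> cab; rewrite mulr_ge0// subr_ge0.
move=> M h E f u; rewrite /split_metric metric_G_m metric_G_tr metric_G_perp.
by rewrite /elastic_metric; ring.
Qed.
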